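(* Every local derivation of the centerless super Virasoro algebra $\mathcal{S}$ is a derivation of $\mathcal{S}$.
   Context: The super Virasoro algebra $\mathrm{SVir}[0]$ is the Lie superalgebra over $\mathbb{C}$ with basis $\{L_m, G_r, C : m\in\mathbb{Z}, r\in\mathbb{Z}\}$, even part spanned by the $L_m$ and $C$, odd part spanned by the $G_r$, and brackets $[L_m,L_n]=(m-n)L_{m+n}+\frac{1}{12}\delta_{m+n,0}(m^3-m)C$, $[L_m,G_r]=(\frac m2-r)G_{m+r}$, $[G_r,G_s]=2L_{r+s}+\frac13\delta_{r+s,0}(r^2-\frac14)C$, with $C$ central. $\mathcal{S}=\mathrm{SVir}[0]/\mathbb{C}C$ is the centerless quotient, with basis (images of) $\{L_m,G_n: m,n\in\mathbb{Z}\}$ and the same brackets with $C=0$. A homogeneous linear map $D$ of parity $|D|\in\mathbb{Z}_2$ on a Lie superalgebra $L$ is a derivation if $D([x,y])=[D(x),y]+(-1)^{|D||x|}[x,D(y)]$ for all homogeneous $x,y$; $\mathrm{Der}(L)$ is the space of derivations (sums of even and odd derivations). A linear map $\Delta:L\to L$ is a local derivation if for every $x\in L$ there is a derivation $D_x\in\mathrm{Der}(L)$ with $\Delta(x)=D_x(x)$. *)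

(* Defs.v *)
(* The centerless super Virasoro algebra S over C = R[i],
   R : realType (any realType is isomorphic to the real numbers). *)
From HB Require Import structures.
From mathcomp Require Import all_boot all_order all_algebra.
From mathcomp Require Import finmap.
From mathcomp.multinomials Require Import monalg.
From mathcomp Require Import reals.
From mathcomp.real_closed Require Import complex.

Set Implicit Arguments.
Unset Strict Implicit.
Unset Printing Implicit Defensive.

Import GRing.Theory Num.Theory.
Local Open Scope ring_scope.

(* Basis of S: inl m = L_m (even), inr n = G_n (odd), m n : int. *)
Definition SVbasis := (int + int)%type.

Definition CC (R : realType) := (R[i])%type.

Definition SV (R : realType) := {malg (CC R)[SVbasis]}.

Definition bparity (k : SVbasis) : bool := if k is inr _ then true else false.

(* Brackets of basis vectors in S (C = 0):
   [L_m, L_n] = (m-n) L_{m+n},  [L_m, G_r] = (m/2 - r) G_{m+r},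
   [G_r, L_m] = - [L_m, G_r],   [G_r, G_s] = 2 L_{r+s}. *)
Definition brb (R : realType) (a b : SVbasis) : SV R :=
  match a, b with
  | inl m, inl n => << ((m - n)%:~R : CC R) *g inl (m + n) >>
  | inl m, inr r => << ((m%:~R / 2 - r%:~R) : CC R) *g inr (m + r) >>
  | inr r, inl m => << (- (m%:~R / 2 - r%:~R) : CC R) *g inr (m + r) >>
  | inr r, inr s => << (2 : CC R) *g inl (r + s) >>
  end.

Definition svbr (R : realType) (x y : SV R) : SV R :=
  \sum_(a <- msupp x) \sum_(b <- msupp y) (x@_a * y@_b) *: brb R a b.

(* x is homogeneous of parity p (0 is homogeneous of both parities). *)
Definition homog (R : realType) (p : bool) (x : SV R) : Prop :=
  forall k, k \in msupp x -> bparity k = p.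

Definition is_linear_map (R : realType) (f : SV R -> SV R) : Prop :=
  forall (c : CC R) (x y : SV R), f (c *: x + y) = c *: f x + f y.

Definition hom_derivation (R : realType) (d : bool) (D : SV R -> SV R) : Prop :=
  [/\ is_linear_map D,
      (forall p x, homog p x -> homog (addb p d) (D x)) &
      (forall p q x y, homog p x -> homog q y ->
         D (svbr x y) = svbr (D x) y + (if d && p then -1 else 1) *: svbr x (D y))].

Definition is_derivation (R : realType) (D : SV R -> SV R) : Prop :=
  exists D0 D1 : SV R -> SV R,
    [/\ hom_derivation false D0, hom_derivation true D1 &
        forall x, D x = D0 x + D1 x].

Definition is_local_derivation (R : realType) (T : SV R -> SV R) : Prop :=
  is_linear_map T /\
  forall x : SV R, exists D, is_derivation D /\ T x = D x.

(* Main.v *)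
(* Every derivation is inner: after subtracting an inner one it kills L_0, hence
   preserves degrees, and the remaining coefficients satisfy linear recurrences.
   So a local derivation T satisfies T x = [a, x] with a depending on x.

   View even and odd elements as Laurent polynomials f, g on the punctured line.
   If the polynomials of x vanish to suitable order at a point z, the first
   derivatives of [a, x] at z satisfy linear relations valid for all a. Applied to
   combinations x of few basis vectors that vanish at z, these relations say that T
   is given by a first order differential operator, whose coefficients are then
   determined because z is arbitrary. In this way T - ad w vanishes on all L_m for
   some w, and a local inner map vanishing on all L_m is zero; for the latter one
   uses x = L_f + G_g with (f, g) = ((t - z)^2, (t - z)^3), (0, t - z),
   (0, t (t - z)) and ((t - z)^3, t - z). *)

Require Import Defs.
From HB Require Import structures.
From mathcomp Require Import all_boot all_order all_algebra.
From mathcomp Require Import reals.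
From mathcomp Require Import finmap.
From mathcomp.multinomials Require Import monalg.
From mathcomp.real_closed Require Import complex.
From mathcomp Require Import ring zify.

Set Implicit Arguments.
Unset Strict Implicit.
Unset Printing Implicit Defensive.

Import GRing.Theory Num.Theory.
Local Open Scope ring_scope.

(* The algebra over an arbitrary field of characteristic zero; at F = R[i] these
   are the notions of Defs, up to unlocking [sbr]. *)
Definition brk (F : numFieldType) (a b : SVbasis) : {malg F[SVbasis]} :=
  match a, b with
  | inl m, inl n => << ((m - n)%:~R : F) *g inl (m + n) >>
  | inl m, inr r => << ((m%:~R / 2 - r%:~R) : F) *g inr (m + r) >>
  | inr r, inl m => << (- (m%:~R / 2 - r%:~R) : F) *g inr (m + r) >>
  | inr r, inr s => << (2 : F) *g inl (r + s) >>
  end.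

HB.lock Definition sbr (F : numFieldType) (x y : {malg F[SVbasis]}) :
    {malg F[SVbasis]} :=
  \sum_(a <- msupp x) \sum_(b <- msupp y) (x@_a * y@_b) *: brk F a b.

Section Definitions.
Context {F : numFieldType}.
Notation S := {malg F[SVbasis]}.

Definition homogeneous (p : bool) (x : S) : Prop :=
  forall k, k \in msupp x -> bparity k = p.

Definition linear_map (f : S -> S) : Prop :=
  forall (c : F) (x y : S), f (c *: x + y) = c *: f x + f y.

Definition hom_der (d : bool) (D : S -> S) : Prop :=
  [/\ linear_map D,
      (forall p x, homogeneous p x -> homogeneous (addb p d) (D x)) &
      (forall p q x y, homogeneous p x -> homogeneous q y ->
         D (sbr x y) = sbr (D x) y + (if d && p then -1 else 1) *: sbr x (D y))].

Definition der (D : S -> S) : Prop :=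
  exists D0 D1 : S -> S,
    [/\ hom_der false D0, hom_der true D1 & forall x, D x = D0 x + D1 x].

Definition local_der (T : S -> S) : Prop :=
  linear_map T /\ forall x : S, exists D, der D /\ T x = D x.

End Definitions.

HB.lock Definition vec (F : numFieldType) (a : SVbasis) : {malg F[SVbasis]} :=
  << (1 : F) *g a >>.

(** Brings all terms of an identity to multiples of one basis vector, so that only scalars remain to
    be compared. *)
Ltac normalize_index n :=
  repeat match goal with
  | |- context [vec _ (_ ?a)] =>
    tryif unify a n then fail else (rewrite (_ : a = n); last by ring)
  end.

Section SuperVirasoro.
Context {F : numFieldType}.
Notation S := {malg F[SVbasis]}.
Notation vec := (vec F).
Notation L m := (vec (inl m)).
Notation G m := (vec (inr m)).

(** * Linear extension from the basis *)

Section LinearExtension.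
Context {V : lmodType F}.

Definition lext (phi : SVbasis -> V) (x : S) : V :=
  \sum_(a <- msupp x) x@_a *: phi a.

Lemma lextEw (phi : SVbasis -> V) (x : S) (d : {fset SVbasis}) :
  (msupp x `<=` d)%fset -> lext phi x = \sum_(a <- d) x@_a *: phi a.
Proof.
move=> le_xd; rewrite /lext (big_fset_incl _ le_xd) // => a _ /mcoeff_outdom ->.
by rewrite scale0r.
Qed.

Lemma lext_is_linear (phi : SVbasis -> V) : linear (lext phi).
Proof.
move=> c x y; pose d := (msupp (c *: x + y) `|` (msupp x `|` msupp y))%fset.
have dx : (msupp x `<=` d)%fset by rewrite /d fsetUCA fsubsetUl.
have dy : (msupp y `<=` d)%fset by rewrite /d fsetUA fsubsetUr.
rewrite (lextEw _ dx) (lextEw _ dy) (@lextEw _ _ d) ?fsubsetUl //.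
rewrite scaler_sumr -big_split; apply: eq_bigr => a _.
by rewrite mcoeffD mcoeffZ scalerDl scalerA.
Qed.

HB.instance Definition _ (phi : SVbasis -> V) :=
  GRing.isLinear.Build F S V *:%R (lext phi) (lext_is_linear phi).

Lemma lextU (phi : SVbasis -> V) c a : lext phi << c *g a >> = c *: phi a.
Proof. by rewrite (lextEw _ msuppU_le) big_seq_fset1 mcoeffUU. Qed.

End LinearExtension.

Lemma malgUZ (c : F) a : << c *g a >> = c *: vec a.
Proof. by apply/malgP=> b; rewrite vec.unlock mcoeffZ !mcoeffU mulrnAr mulr1. Qed.

Lemma lext_vec (V : lmodType F) (phi : SVbasis -> V) a : lext phi (vec a) = phi a.
Proof. by rewrite vec.unlock lextU scale1r. Qed.

(** Remembering that [a] lies in the support of [x] is what makes an induction inside one parity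
    possible. *)
Lemma supp_ind (P : S -> Prop) (x : S) :
  P 0 -> (forall c a y, a \in msupp x -> P y -> P (c *: vec a + y)) -> P x.
Proof.
move=> P0 PD; have -> : x = \sum_(a <- msupp x | a \in msupp x) x@_a *: vec a.
  by rewrite -big_seq {1}[x]monalgE; apply: eq_bigr => a _; rewrite malgUZ.
by apply: big_rec => // a y ax Py; apply: PD.
Qed.

Lemma vec_ind (P : S -> Prop) :
  P 0 -> (forall c a y, P y -> P (c *: vec a + y)) -> forall x, P x.
Proof. by move=> P0 PD x; apply: supp_ind => // c a y _; exact: PD. Qed.

Lemma linear_basis_eq (V : lmodType F) (f g : {linear S -> V}) :
  (forall a, f (vec a) = g (vec a)) -> f =1 g.
Proof.
move=> fg; apply: vec_ind => [|c a y IH]; first by rewrite !linear0.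
by rewrite !linearP fg IH.
Qed.

(** * Bilinearity of the bracket *)

Lemma sbr_lext (x y : S) : sbr x y = lext (fun a => lext (brk F a) y) x.
Proof.
rewrite sbr.unlock; apply: eq_bigr => a _; rewrite scaler_sumr.
by apply: eq_bigr => b _; rewrite scalerA.
Qed.

Lemma sbr_is_linear (x : S) : linear (sbr x).
Proof.
move=> c y z; rewrite !sbr_lext scaler_sumr -big_split; apply: eq_bigr => a _ /=.
by rewrite linearP scalerDr !scalerA mulrC.
Qed.

HB.instance Definition _ x :=
  GRing.isLinear.Build F S S *:%R (sbr x) (sbr_is_linear x).

(** Gives linearity in the first argument a head symbol on which it can be registered. *)
Definition sbrl (y x : S) := sbr x y.

Lemma sbrl_is_linear (y : S) : linear (sbrl y).
Proof. by move=> c x z; rewrite /sbrl !sbr_lext linearP. Qed.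

HB.instance Definition _ y :=
  GRing.isLinear.Build F S S *:%R (sbrl y) (sbrl_is_linear y).

Lemma sbrDl x x' y : sbr (x + x') y = sbr x y + sbr x' y :> S.
Proof. exact: (linearD (sbrl y)). Qed.
Lemma sbrBl x x' y : sbr (x - x') y = sbr x y - sbr x' y :> S.
Proof. exact: (linearB (sbrl y)). Qed.
Lemma sbrZl c x y : sbr (c *: x) y = c *: sbr x y :> S.
Proof. exact: (linearZ_LR (sbrl y)). Qed.
Lemma sbr0l y : sbr 0 y = 0 :> S.
Proof. exact: (linear0 (sbrl y)). Qed.
Definition sbrD x y y' : sbr x (y + y') = sbr x y + sbr x y' :> S :=
  linearD (sbr x) y y'.
Definition sbrB x y y' : sbr x (y - y') = sbr x y - sbr x y' :> S :=
  linearB (sbr x) y y'.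
Definition sbrZ x c y : sbr x (c *: y) = c *: sbr x y :> S :=
  linearZ_LR (sbr x) c y.
Definition sbr0 x : sbr x 0 = 0 :> S := linear0 (sbr x).

Lemma sbrUU a b : sbr (vec a) (vec b) = brk F a b.
Proof. by rewrite sbr_lext !lext_vec. Qed.

Lemma sbrLL m n : sbr (L m) (L n) = (m - n)%:~R *: L (m + n).
Proof. by rewrite sbrUU /= malgUZ. Qed.
Lemma sbrLG m r : sbr (L m) (G r) = (m%:~R / 2 - r%:~R) *: G (m + r).
Proof. by rewrite sbrUU /= malgUZ. Qed.
Lemma sbrGL r m : sbr (G r) (L m) = (r%:~R - m%:~R / 2) *: G (m + r).
Proof. by rewrite sbrUU /= malgUZ opprB. Qed.
Lemma sbrGG r s : sbr (G r) (G s) = 2 *: L (r + s).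
Proof. by rewrite sbrUU /= malgUZ. Qed.

(** * Parity and the super Jacobi identity *)

Lemma homog0 p : homogeneous p (0 : S).
Proof. by move=> k; rewrite msupp0. Qed.
Lemma homogD p (x y : S) :
  homogeneous p x -> homogeneous p y -> homogeneous p (x + y).
Proof.
move=> hx hy k /(fsubsetP (msuppD_le _ _)).
by rewrite in_fsetU => /orP[/hx|/hy].
Qed.
Lemma homogZ p c (x : S) : homogeneous p x -> homogeneous p (c *: x).
Proof. by move=> hx k /(fsubsetP (msuppZ_le _ _))/hx. Qed.
Lemma homogU a : homogeneous (bparity a) (vec a).
Proof.
by rewrite vec.unlock => k /(fsubsetP msuppU_le); rewrite in_fset1 => /eqP->.
Qed.

Lemma homog_ind p (P : S -> Prop) :
  P 0 -> (forall c a y, bparity a = p -> P y -> P (c *: vec a + y)) ->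
  forall x, homogeneous p x -> P x.
Proof.
by move=> P0 PD x hx; apply: supp_ind => // c a y /hx; apply: PD.
Qed.

Lemma homog_sbr p q (x y : S) :
  homogeneous p x -> homogeneous q y -> homogeneous (p (+) q) (sbr x y).
Proof.
move=> hx hy; move: x hx; apply: homog_ind => [|c a x pa IH].
  by rewrite sbr0l; exact: homog0.
rewrite sbrDl sbrZl; apply: homogD => //; apply: homogZ => {x IH}.
move: y hy; apply: homog_ind => [|d b y qb IH].
  by rewrite sbr0; exact: homog0.
rewrite sbrD sbrZ; apply: homogD => //; apply: homogZ.
have hL m : homogeneous false (L m) by exact: (@homogU (inl m)).
have hG m : homogeneous true (G m) by exact: (@homogU (inr m)).
rewrite -pa -qb; case: a b {pa qb IH} => m [] n /=.
- by rewrite sbrLL; exact/homogZ/hL.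
- by rewrite sbrLG; exact/homogZ/hG.
- by rewrite sbrGL; exact/homogZ/hG.
- by rewrite sbrGG; exact/homogZ/hL.
Qed.


Ltac expand_sbr :=
  rewrite ?sbrDl ?sbrD ?sbrBl ?sbrB ?sbrZl ?sbrZ ?sbrLL ?sbrLG ?sbrGL ?sbrGG.

(** All terms are multiples of the basis vector of index [i + j + k] of one parity, so each of the
    eight cases is an identity between scalars. *)
Lemma super_jacobi_basis a b c :
  sbr (vec a) (sbr (vec b) (vec c)) = sbr (sbr (vec a) (vec b)) (vec c)
    + (if bparity a && bparity b then -1 else 1)
        *: sbr (vec b) (sbr (vec a) (vec c)).
Proof.
case: a b c => i [] j [] k /=.
all: do 2! expand_sbr.
all: rewrite !scalerA.
all: normalize_index (i + j + k).
all: rewrite -scalerDl; congr (_ *: _).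
all: rewrite ?rmorphD ?rmorphB ?rmorphN /=.
all: by field. 
Qed.
(** * Inner derivations *)

Lemma scaleAC (a b : F) (x : S) : a *: (b *: x) = b *: (a *: x).
Proof. by rewrite !scalerA mulrC. Qed.

(** The sign depends only on [d] and [p]; once these are fixed, both sides are linear in each
    argument and basis vectors suffice. *)
Lemma super_jacobi d p (w x y : S) : homogeneous d w -> homogeneous p x ->
  sbr w (sbr x y) =
    sbr (sbr w x) y + (if d && p then -1 else 1) *: sbr x (sbr w y).
Proof.
move=> hw hx; move: w hw; apply: homog_ind => [|c a w <- IH].
  by rewrite !sbr0l sbr0 scaler0 addr0.
rewrite !sbrDl !sbrZl sbrD sbrZ scalerDr [X in _ = X]addrACA -IH.
apply: (congr2 +%R); last by [].
rewrite scaleAC -scalerDr; congr (_ *: _) => {w c IH}.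
move: x hx; apply: homog_ind => [|c b x <- IH].
  by rewrite !sbr0l sbr0 sbr0l scaler0 addr0.
rewrite !sbrDl !sbrZl !sbrD !sbrZ sbrDl sbrZl scalerDr [X in _ = X]addrACA -IH.
apply: (congr2 +%R); last by [].
rewrite scaleAC -scalerDr; congr (_ *: _) => {x c IH}.
move: y; apply: vec_ind => [|c e y IH]; first by rewrite !sbr0 scaler0 addr0.
rewrite !sbrD !sbrZ scalerDr [X in _ = X]addrACA -IH.
apply: (congr2 +%R); last by [].
by rewrite scaleAC -scalerDr super_jacobi_basis.
Qed.

Lemma sbr_supersym p q (x y : S) : homogeneous p x -> homogeneous q y ->
  sbr y x = (if p && q then 1 else -1) *: sbr x y.
Proof.
move=> hx hy; move: x hx; apply: homog_ind => [|c a x <- IH].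
  by rewrite sbr0 sbr0l scaler0.
rewrite sbrDl sbrD sbrZ sbrZl scalerDr IH; apply: (congr2 +%R); last by [].
rewrite scaleAC; congr (_ *: _) => {x c IH}.
move: y hy; apply: homog_ind => [|c b y <- IH].
  by rewrite sbr0 sbr0l scaler0.
rewrite sbrDl sbrD sbrZ sbrZl scalerDr IH; apply: (congr2 +%R); last by [].
rewrite scaleAC; congr (_ *: _) => {y c IH}.
case: a b => m [] n /=; rewrite ?sbrLL ?sbrLG ?sbrGL ?sbrGG ?scale1r //.
- by rewrite scalerA [n + m]addrC -(opprB m) rmorphN mulN1r.
- by rewrite scalerA mulN1r opprB.
- by rewrite scalerA mulN1r opprB.
- by rewrite [n + m]addrC.
Qed.

Lemma homog_split (w : S) :
  exists w0 w1, [/\ homogeneous false w0, homogeneous true w1 & w = w0 + w1].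
Proof.
move: w; apply: vec_ind => [|c a w [w0] [w1] [h0 h1 ->]].
  by exists 0, 0; split; rewrite ?addr0 //; exact: homog0.
have ha := @homogZ _ c _ (@homogU a).
case: a ha => m /= hm.
- exists (c *: L m + w0), w1; split=> //; last by rewrite addrA.
  exact: homogD.
- exists w0, (c *: G m + w1); split=> //; last by rewrite addrCA.
  exact: homogD.
Qed.

Lemma hom_der_ad d (w : S) : homogeneous d w -> hom_der d (sbr w).
Proof.
move=> hw; split=> [c x y|p x hx|p q x y hx _].
- by rewrite sbrD sbrZ.
- by rewrite addbC; exact: homog_sbr.
- exact: super_jacobi.
Qed.

Lemma der_ad (w : S) : der (sbr w).
Proof.
have [w0 [w1 [h0 h1 ->]]] := homog_split w.
by exists (sbr w0), (sbr w1); split=> [||x]; rewrite ?sbrDl //; exact: hom_der_ad.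
Qed.

(** * Derivations are inner *)

(* The consequences of [der] that involve no sign, and hence make sense for a
   derivation that is not homogeneous; they suffice to show that it is inner. *)
Definition weak_der (D : S -> S) : Prop :=
  (forall m b, D (sbr (L m) (vec b)) =
     sbr (D (L m)) (vec b) + sbr (L m) (D (vec b))) /\
  D (L 0) = sbr (D (G 0)) (G 0).

Lemma der_linear (D : S -> S) : der D -> linear_map D.
Proof.
case=> D0 [D1 [[l0 _ _] [l1 _ _] DE]] c x y.
by rewrite !DE l0 l1 scalerDr addrACA.
Qed.

(** No sign arises for the even [L m]. For [G_0, G_0] = 2 L_0, the sign of the odd component of [D]
    is compensated by supersymmetry, so both components give 2 [D G_0, G_0]. *)
Lemma der_weak_der (D : S -> S) : der D -> weak_der D.
Proof.
case=> D0 [D1 [[l0 p0 d0] [l1 p1 d1] DE]]; split=> [m b|].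
  have hb := @homogU b; have hm := @homogU (inl m).
  rewrite !DE (d0 _ _ _ _ hm hb) (d1 _ _ _ _ hm hb) /= !scale1r.
  by rewrite sbrDl sbrD; exact: addrACA.
have hG := @homogU (inr 0).
have two0 : (2 : F) != 0 by rewrite pnatr_eq0.
have two (x : S) : x + x = 2 *: x by rewrite -mulr2n scaler_nat.
have D0L := d0 _ _ _ _ hG hG; have D1L := d1 _ _ _ _ hG hG.
rewrite /= scale1r (sbr_supersym (p0 _ _ hG) hG) /= scale1r two in D0L.
rewrite /= (sbr_supersym (p1 _ _ hG) hG) /= scalerA mulN1r opprK scale1r two
  in D1L.
apply: (scalerI two0); rewrite !DE sbrDl !scalerDr -D0L -D1L sbrGG.
have lZ (f : S -> S) : linear_map f -> forall c x, f (c *: x) = c *: f x.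
  move=> lf c x; have f0 : f 0 = 0.
    by have := lf (-1) 0 0; rewrite scaler0 addr0 scaleN1r addNr.
  by rewrite -[c *: x]addr0 lf f0 addr0.
by rewrite (lZ D0 l0) (lZ D1 l1) addr0.
Qed.

Definition idx (a : SVbasis) : int := match a with inl m | inr m => m end.

Lemma sbrC_L m (x : S) : sbr x (L m) = - sbr (L m) x.
Proof.
have [x0 [x1 [h0 h1 ->]]] := homog_split x; have hL := @homogU (inl m).
rewrite sbrDl sbrD opprD (sbr_supersym hL h0) (sbr_supersym hL h1) /=.
by rewrite !scaleN1r.
Qed.

Lemma sbrL0 a : sbr (L 0) (vec a) = - (idx a)%:~R *: vec a.
Proof.
by case: a => m; rewrite ?sbrLL ?sbrLG !add0r ?rmorphN ?mul0r ?add0r.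
Qed.

Lemma mcoeff_vec a b : (vec a)@_b = (a == b)%:R.
Proof. by rewrite vec.unlock mcoeffU. Qed.

Lemma mcoeff_lext_diag (k : SVbasis -> F) (x : S) b :
  (lext (fun a => k a *: vec a) x)@_b = x@_b * k b.
Proof.
move: x; apply: vec_ind => [|c a x IH].
  by rewrite linear0 !mcoeff0 mul0r.
rewrite linearP /= !mcoeffD !mcoeffZ IH mulrDl lext_vec.
rewrite mcoeffZ mcoeff_vec.
by have [->|_] := eqVneq a b; rewrite /= ?mul0r ?mulr0 ?mul0r ?mulr1 // mulrA.
Qed.

Lemma mcoeff_sbrL0 (x : S) b : (sbr (L 0) x)@_b = - (idx b)%:~R * x@_b.
Proof.
move: x; apply: vec_ind => [|c a x IH].
  by rewrite linear0 !mcoeff0 mulr0.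
rewrite linearP /= !mcoeffD !mcoeffZ IH mulrDr sbrL0 mcoeffZ mcoeff_vec.
by have [->|_] := eqVneq a b; rewrite /= ?mulr0 // mulr1 mulrCA mulrA mulr1.
Qed.

Lemma mcoeff_sbr_L1 (x : S) :
  (sbr x (L 1))@_(inl 1) = - x@_(inl 0) /\
  (sbr x (L 1))@_(inr 1) = - (x@_(inr 0) / 2).
Proof.
move: x; apply: vec_ind => [|c a x [IH1 IH2]].
  by rewrite sbr0l !mcoeff0 mul0r !oppr0.
rewrite sbrDl sbrZl !mcoeffD !mcoeffZ IH1 IH2.
suff [-> ->] : (sbr (vec a) (L 1))@_(inl 1) = - (vec a)@_(inl 0) /\
    (sbr (vec a) (L 1))@_(inr 1) = - ((vec a)@_(inr 0) / 2).
  by split; [ring | field].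
have eq10 (m : int) : (m + 1 == 1) = (m == 0) by rewrite -subr_eq0 addrK.
case: a => m; rewrite ?sbrLL ?sbrGL !mcoeffZ !mcoeff_vec ?[1 + m]addrC.
  rewrite !(inj_eq (@inl_inj _ _)) eq10 /=.
  rewrite !mulr0 mul0r oppr0.
  have [->|_] := eqVneq m 0; last by rewrite mulr0 oppr0.
  by rewrite mulr1 add0r rmorphN.
rewrite !(inj_eq (@inr_inj _ _)) eq10 /= !mulr0 oppr0.
have [->|_] := eqVneq m 0; last by rewrite mulr0 mul0r oppr0.
by rewrite mulr1 add0r.
Qed.

Lemma sum_two_coeffs n (x : S) : (forall b, idx b != n -> x@_b = 0) ->
  x = x@_(inl n) *: L n + x@_(inr n) *: G n.
Proof.
move=> x0; apply/malgP=> b; rewrite mcoeffD !mcoeffZ !mcoeff_vec.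
have [bn|bn] := eqVneq (idx b) n.
  by case: b bn => m /= ->; rewrite eqxx /= mulr1 mulr0 ?addr0 ?add0r.
rewrite [LHS]x0 //; case: b bn => m /= mn.
  by rewrite (inj_eq (@inl_inj _ _)) [n == m]eq_sym (negPf mn) /= !mulr0 addr0.
by rewrite (inj_eq (@inr_inj _ _)) [n == m]eq_sym (negPf mn) /= !mulr0 addr0.
Qed.

Lemma weak_der_sub (D : {linear S -> S}) (w : S) :
  weak_der D -> weak_der (D \- sbr w).
Proof.
case=> dL dG; have [aL aG] := der_weak_der (der_ad w); split=> [m b|] /=.
  by rewrite dL aL !sbrBl !sbrB opprD addrACA.
by rewrite dG aG sbrBl.
Qed.

(** Bracketing with L_0 is invertible outside degree 0. The degree 0 part of D L_0 vanishes: in the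
    degree 1 part of D [L_0, L_1], the terms in D L_1 cancel and leave the degree 1 part of
    [D L_0, L_1]. *)
Lemma weak_der_L0 (D : {linear S -> S}) : weak_der D ->
  exists w, D (L 0) = sbr w (L 0).
Proof.
(* The map [-, L_0] multiplies degree m by m. In degree 0 the inverse is 0 by convention, which
   agrees with [uz]. *)
case=> dL _; exists (lext (fun a => (idx a)%:~R^-1 *: vec a) (D (L 0))).
have := dL 0 (inl 1); rewrite sbrL0 linearZ /= => dL1.
have [e1 e2] := mcoeff_sbr_L1 (D (L 0)).
have uz b : idx b = 0 -> (D (L 0))@_b = 0.
  case: b => m /= ->.
    have := congr1 (mcoeff (inl 1)) dL1.
    rewrite mcoeffD mcoeffZ mcoeff_sbrL0 e1 /= => /eqP.
    by rewrite -subr_eq subrr eq_sym oppr_eq0 => /eqP.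
  have := congr1 (mcoeff (inr 1)) dL1.
  rewrite mcoeffD mcoeffZ mcoeff_sbrL0 e2 /= => /eqP.
  rewrite -subr_eq subrr eq_sym oppr_eq0 mulf_eq0 invr_eq0 pnatr_eq0 orbF.
  by move/eqP.
apply/malgP=> b; rewrite sbrC_L mcoeffN mcoeff_sbrL0 mcoeff_lext_diag.
rewrite mulNr opprK mulrC.
have [/uz->|nz] := eqVneq (idx b) 0; first by rewrite !mul0r.
by rewrite divfK // intr_eq0.
Qed.

(** Such a map commutes with ad L_0, hence preserves its eigenspaces, which are spanned by [L n] and
    [G n]. *)
Lemma weak_der_degree0 (D : {linear S -> S}) b : weak_der D -> D (L 0) = 0 ->
  D (vec b) = (D (vec b))@_(inl (idx b)) *: L (idx b)
            + (D (vec b))@_(inr (idx b)) *: G (idx b).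
Proof.
case=> dL _ D0; apply: sum_two_coeffs => c ncb.
have := congr1 (mcoeff c) (dL 0 b).
rewrite sbrL0 linearZ /= D0 sbr0l add0r mcoeffZ mcoeff_sbrL0 => /eqP.
rewrite -subr_eq0 -mulrBl mulf_eq0 opprK addrC subr_eq0.
by rewrite eqr_int (negPf ncb) => /eqP.
Qed.

Lemma eq_lincomb2 (a b a' b' : F) (x y : S) :
  a = a' -> b = b' -> a *: x + b *: y = a' *: x + b' *: y.
Proof. by move=> -> ->. Qed.

(** The step at 1 is excluded because it will come from [L_m, L_1], whose factor m - 1 vanishes
    there; the value at 2 is supplied instead. *)
Lemma int_linear_rec (f : int -> F) :
  f 0 = 0 -> f 2 = 2 * f 1 -> (forall m, f (- m) = - f m) ->
  (forall m, m != 1 -> f m = m%:~R * f 1 -> f (m + 1) = (m + 1)%:~R * f 1) ->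
  forall m, f m = m%:~R * f 1.
Proof.
move=> f0 f2 fN fS; have fnat (n : nat) : f n = n%:~R * f 1.
  elim: n => [|n IH]; first by rewrite f0 mul0r.
  rewrite -addn1 PoszD; have [n1|n1] := eqVneq (n : int) 1; last exact: fS.
  by rewrite n1 f2.
by case=> n //; rewrite NegzE fN fnat rmorphN mulNr.
Qed.

Lemma witt_cocycle_even (c : int -> F) :
  (forall m n, (m - n)%:~R * c (m + n) = (m - n)%:~R * (c m + c n)) ->
  forall m, c m = m%:~R * c 1.
Proof.
move=> cD.
have c0 : c 0 = 0.
  have := cD 1 0; rewrite subr0 !mul1r => /eqP.
  by rewrite addrC -subr_eq subrr eq_sym => /eqP.
have cN m : c (- m) = - c m.
  have [->|m0] := eqVneq m 0; first by rewrite oppr0 c0 oppr0.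
  have := cD m (- m); rewrite opprK subrr c0 mulr0 => /esym/eqP.
  rewrite mulf_eq0 intr_eq0 -mulr2n mulrn_eq0 (negPf m0) /=.
  by rewrite addrC addr_eq0 => /eqP.
apply: int_linear_rec => // [|m m1 cm].
  have := cD 2 (-1); rewrite cN; set k := (_ - _)%:~R.
  have k0 : k != 0 by rewrite intr_eq0.
  move/(mulfI k0) => c1; have {}c1 : c 1 = c 2 - c 1 := c1.
  have -> : c 2 = (c 2 - c 1) + c 1 by ring.
  by rewrite -c1; ring.
have := cD m 1; rewrite cm; set k := (_ - _)%:~R.
have k0 : k != 0 by rewrite intr_eq0 subr_eq0.
by move/(mulfI k0) => ->; rewrite rmorphD; ring.
Qed.

(** This is the relation for the [G] coefficients of a degree-preserving derivation on the [L m].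
    The pairs (1, 0), (m, -m), (2, -1) and (m, 1) give, in turn, the hypotheses of
    [int_linear_rec]. *)
Lemma witt_cocycle_odd (d : int -> F) :
  (forall m n, (m - n)%:~R * d (m + n) =
     d m * (m%:~R - n%:~R / 2) + d n * (m%:~R / 2 - n%:~R)) ->
  forall m, d m = m%:~R * d 1.
Proof.
move=> dD.
have d0 : d 0 = 0.
  have := dD 1 0; rewrite subr0 !mul1r => h.
  have -> : d 0 = 2 * (d 1 - d 1 * (1 - 0 / 2)) by rewrite {1}h; field.
  by field.
have dN m : d (- m) = - d m.
  have [->|m0] := eqVneq m 0; first by rewrite oppr0 d0 oppr0.
  have := dD m (- m); rewrite opprK subrr d0 mulr0 rmorphN => h.
  have m0' : m%:~R != 0 :> F by rewrite intr_eq0.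
  have : m%:~R * (d m + d (- m)) = 0.
    have -> : m%:~R * (d m + d (- m)) =
      2 / 3 * (d m * (m%:~R - - m%:~R / 2) + d (- m) * (m%:~R / 2 - - m%:~R)).
      by field.
    by rewrite -h mulr0.
  by move/eqP; rewrite mulf_eq0 (negPf m0') /= addrC addr_eq0 => /eqP.
apply: int_linear_rec => // [|m m1 dm].
  have := dD 2 (-1); rewrite dN rmorphB rmorphN /= => h.
  have -> : d 2 = 2 / 5 * ((d 2 * (2 - -1 / 2) + - d 1 * (2 / 2 - -1)) + 2 * d 1).
    by field.
  by rewrite -[X in X + _]h; field.
have := dD m 1; rewrite dm => h.
have k0 : (m - 1)%:~R != 0 :> F by rewrite intr_eq0 subr_eq0.
by apply: (mulfI k0); rewrite h !rmorphD rmorphN /=; field.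
Qed.

Lemma weak_der_L (D : {linear S -> S}) : weak_der D ->
  exists w, forall m, D (L m) = sbr w (L m).
Proof.
move=> wD; have [w Dw] := weak_der_L0 wD.
pose E : {linear S -> S} := D \- sbr w; have wE : weak_der E := weak_der_sub w wD.
have E0 : E (L 0) = 0 by rewrite /E /= Dw subrr.
pose c m := (E (L m))@_(inl m); pose d m := (E (L m))@_(inr m).
have EL m : E (L m) = c m *: L m + d m *: G m.
  exact: (weak_der_degree0 (inl m) wE E0).
have ELL m n : (m - n)%:~R *: (c (m + n) *: L (m + n) + d (m + n) *: G (m + n))
    = ((m - n)%:~R * (c m + c n)) *: L (m + n) +
      (d m * (m%:~R - n%:~R / 2) + d n * (m%:~R / 2 - n%:~R)) *: G (m + n).
  have -> : (m - n)%:~R *: (c (m + n) *: L (m + n) + d (m + n) *: G (m + n)) =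
      E (sbr (L m) (L n)) by rewrite sbrLL -EL linearZ_LR.
  rewrite (wE.1 m (inl n)) !EL.
  rewrite !sbrDl !sbrD !sbrZl !sbrZ !sbrLL sbrLG sbrGL !scalerA [n + m]addrC.
  by rewrite addrACA -!scalerDl; apply: eq_lincomb2; ring.
have cE := witt_cocycle_even (c := c); have dE := witt_cocycle_odd (d := d).
have {}cE m : c m = m%:~R * c 1.
  apply: cE => {}m n; have := congr1 (mcoeff (inl (m + n))) (ELL m n).
  by rewrite !mcoeffZ !mcoeffD !mcoeffZ !mcoeff_vec eqxx /= !mulr0 !addr0 !mulr1.
have {}dE m : d m = m%:~R * d 1.
  apply: dE => {}m n; have := congr1 (mcoeff (inr (m + n))) (ELL m n).
  by rewrite !mcoeffZ !mcoeffD !mcoeffZ !mcoeff_vec eqxx /= !mulr0 !add0r !mulr1.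
(* The constants invert [L_0, L_m] = -m L_m and [G_0, L_m] = -(m/2) G_m. *)
exists (w + ((- c 1) *: L 0 + (- 2 * d 1) *: G 0)) => m.
rewrite sbrDl -[LHS](subrK (sbr w (L m))) [LHS]addrC.
apply: (congr2 +%R); first by [].
rewrite -[LHS]/(E (L m)) EL sbrDl !sbrZl sbrLL sbrGL !scalerA !add0r addr0.
by rewrite cE dE; apply: eq_lincomb2; rewrite ?rmorphN /=; field.
Qed.

(** After subtraction of an inner map, commuting with every ad L_m still allows a scalar on the odd
    part; the relation [G_0, G_0] = 2 L_0 excludes it. *)
Lemma weak_der_inner (D : {linear S -> S}) : weak_der D ->
  exists w, D =1 sbr w.
Proof.
move=> wD; have [w Dw] := weak_der_L wD; exists w.
pose E : {linear S -> S} := D \- sbr w; have wE : weak_der E := weak_der_sub w wD.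
have EL m : E (L m) = 0 by rewrite /E /= Dw subrr.
pose h m := (E (G m))@_(inl m); pose e m := (E (G m))@_(inr m).
have EG m : E (G m) = h m *: L m + e m *: G m.
  exact: (weak_der_degree0 (inr m) wE (EL 0)).
have ELG m n :
    (m%:~R / 2 - n%:~R) *: (h (m + n) *: L (m + n) + e (m + n) *: G (m + n))
    = (h n * (m - n)%:~R) *: L (m + n) +
      (e n * (m%:~R / 2 - n%:~R)) *: G (m + n).
  have -> : (m%:~R / 2 - n%:~R) *:
        (h (m + n) *: L (m + n) + e (m + n) *: G (m + n)) =
      E (sbr (L m) (G n)) by rewrite sbrLG -EG linearZ_LR.
  rewrite (wE.1 m (inr n)) EL sbr0l add0r EG.
  by rewrite sbrD !sbrZ sbrLL sbrLG !scalerA.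
have hE m n : (m%:~R / 2 - n%:~R) * h (m + n) = h n * (m - n)%:~R.
  have := congr1 (mcoeff (inl (m + n))) (ELG m n).
  by rewrite !mcoeffZ !mcoeffD !mcoeffZ !mcoeff_vec eqxx /= !mulr0 !addr0 !mulr1.
have eE m n : (m%:~R / 2 - n%:~R) * e (m + n) = e n * (m%:~R / 2 - n%:~R).
  have := congr1 (mcoeff (inr (m + n))) (ELG m n).
  by rewrite !mcoeffZ !mcoeffD !mcoeffZ !mcoeff_vec eqxx /= !mulr0 !add0r !mulr1.
have h0' n : n != 0 -> h n = 0.
  (* At m = 2n the factor m/2 - n is zero, which leaves n h(n) = 0. *)
  move=> n0; have := hE (n + n) n; rewrite addrK => h1.
  have n0' : n%:~R != 0 :> F by rewrite intr_eq0.
  by apply: (mulIf n0'); rewrite -h1 rmorphD mul0r; field.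
have h0 n : h n = 0.
  have [->|/h0' //] := eqVneq n 0.
  by have := hE 1 0; rewrite h0' // mulr0 mulr1.
have e0 : e 0 = 0.
  have := wE.2; rewrite EL EG h0 scale0r add0r sbrZl sbrGG => /esym/eqP.
  move/eqP/(congr1 (mcoeff (inl (0 + 0)))).
  rewrite !mcoeffZ mcoeff_vec mcoeff0 eqxx mulr1 => /eqP.
  by rewrite mulf_eq0 pnatr_eq0 orbF => /eqP.
have {}e0 n : e n = 0.
  have [->|n0] := eqVneq n 0; first exact: e0.
  have n0' : n%:~R != 0 :> F by rewrite intr_eq0.
  have := eE n 0; rewrite addr0 e0 mul0r mulr0z subr0 => /eqP.
  by rewrite !mulf_eq0 invr_eq0 pnatr_eq0 (negPf n0') => /eqP.
apply: linear_basis_eq => -[] m; first exact: Dw.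
apply/eqP; rewrite -subr_eq0; apply/eqP.
by rewrite -[LHS]/(E (G m)) EG h0 e0 !scale0r addr0.
Qed.

Lemma der_inner (D : S -> S) : der D -> exists w, D =1 sbr w.
Proof.
move=> dD; pose E : {linear S -> S} :=
  HB.pack D (GRing.isLinear.Build F S S *:%R D (der_linear dD)).
exact: (@weak_der_inner E (der_weak_der dD)).
Qed.

(** * Derivatives of the bracket at a point *)

Lemma vec_ind2 (P : S -> S -> Prop) :
  (forall x, P 0 x) -> (forall a, P a 0) ->
  (forall c a a' x, P a x -> P a' x -> P (c *: a + a') x) ->
  (forall c a x x', P a x -> P a x' -> P a (c *: x + x')) ->
  (forall a b, P (vec a) (vec b)) -> forall a x, P a x.
Proof.
move=> P0l P0r Pl Pr Pv a x; move: a; apply: vec_ind => // c a a' Pa.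
apply: Pl => //; move: x {Pa}; apply: vec_ind => // d b x' Px'; exact: Pr.
Qed.

(* The k-th derivative, for z d/dz, of the Laurent polynomial of the parity p part
   of an element. *)
Definition jet (p : bool) (k : nat) (z : F) : S -> F :=
  lext (V := F^o)
    (fun a => if bparity a == p then (idx a)%:~R ^+ k * z ^ idx a else 0).

Lemma jet_is_scalar p k z : scalar (jet p k z).
Proof. exact: (lext_is_linear (V := F^o)). Qed.

HB.instance Definition _ p k z :=
  GRing.isLinear.Build F S F *%R (jet p k z) (jet_is_scalar p k z).

Lemma jetD p k z x y : jet p k z (x + y) = jet p k z x + jet p k z y.
Proof. exact: linearD. Qed.
Lemma jetB p k z x y : jet p k z (x - y) = jet p k z x - jet p k z y.
Proof. exact: linearB. Qed.
Lemma jetZ p k z c x : jet p k z (c *: x) = c * jet p k z x.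
Proof. exact: scalarZ. Qed.
Lemma jet0 p k z : jet p k z 0 = 0.
Proof. exact: linear0. Qed.
Lemma jet_vec p k z a : jet p k z (vec a) =
  if bparity a == p then (idx a)%:~R ^+ k * z ^ idx a else 0.
Proof. exact: (lext_vec (V := F^o)). Qed.

(* Writing L_f for sum_m f_m L_m, where f = sum_m f_m z^m, G_g likewise, and ' for
   z d/dz, the bracket of a = L_u + G_v and x = L_f + G_g is
   L_{u'f - uf' + 2vg} + G_{fv' - f'v/2 + u'g/2 - ug'}; these are the first
   derivatives of that formula at z. *)
Lemma jet_bracket z a x : z != 0 ->
  [/\ jet false 0 z (sbr a x) = jet false 1 z a * jet false 0 z x
        - jet false 0 z a * jet false 1 z x + 2 * (jet true 0 z a * jet true 0 z x),
      jet false 1 z (sbr a x) = jet false 2 z a * jet false 0 z x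
        - jet false 0 z a * jet false 2 z x
        + 2 * (jet true 1 z a * jet true 0 z x + jet true 0 z a * jet true 1 z x),
      jet true 0 z (sbr a x) = jet false 0 z x * jet true 1 z a
        - jet false 1 z x * jet true 0 z a / 2
        + jet false 1 z a * jet true 0 z x / 2 - jet false 0 z a * jet true 1 z x,
      jet true 1 z (sbr a x) = jet false 0 z x * jet true 2 z a
        + jet false 1 z x * jet true 1 z a / 2
        - jet false 2 z x * jet true 0 z a / 2
        + jet false 2 z a * jet true 0 z x / 2
        - jet false 1 z a * jet true 1 z x / 2 - jet false 0 z a * jet true 2 z x &
      jet true 2 z (sbr a x) = jet false 0 z x * jet true 3 z a
        + 3 / 2 * (jet false 1 z x * jet true 2 z a)
        - jet false 3 z x * jet true 0 z a / 2
        + jet false 3 z a * jet true 0 z x / 2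
        - 3 / 2 * (jet false 1 z a * jet true 2 z x)
        - jet false 0 z a * jet true 3 z x].
Proof.
move=> z0; move: a x; apply: vec_ind2 => [x|a|c a a' x|c a x x'|a b].
- by rewrite sbr0l !jet0; split; ring.
- by rewrite sbr0 !jet0; split; ring.
- move=> [e0 e1 o0 o1 o2] [f0 f1 p0 p1 p2].
  rewrite sbrDl sbrZl !jetD !jetZ e0 e1 o0 o1 o2 f0 f1 p0 p1 p2.
  by split; ring.
- move=> [e0 e1 o0 o1 o2] [f0 f1 p0 p1 p2].
  rewrite sbrD sbrZ !jetD !jetZ e0 e1 o0 o1 o2 f0 f1 p0 p1 p2.
  by split; ring.
case: a b => m [] n; rewrite ?sbrLL ?sbrLG ?sbrGL ?sbrGG !jetZ !jet_vec /=.
all: rewrite ?expfzDr // ?rmorphD ?rmorphB /=; by split; field.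
Qed.

(** Multiplying by z^N clears the negative exponents; the resulting polynomial vanishes at every
    positive integer, too many roots in characteristic zero. *)
Lemma jet_eq0_coef p (x : S) : (forall z, z != 0 -> jet p 0 z x = 0) ->
  forall b, bparity b = p -> x@_b = 0.
Proof.
move=> x0 b bp; pose N := (\max_(a <- msupp x) `|idx a|)%N.
pose e a := absz (idx a + N%:Z).
have ge0 a : a \in msupp x -> (e a)%:Z = idx a + N.
  move=> ax; apply: gez0_abs.
  have : (`|idx a| <= N)%N by rewrite /N; apply: leq_bigmax_seq.
  lia.
pose P := \sum_(a <- msupp x | bparity a == p) x@_a *: 'X^(e a).
have Pz z : z != 0 -> P.[z] = 0.
  move=> z0; have := x0 z z0; rewrite /jet /lext => xz0.
  rewrite -[RHS](mulr0 (z ^+ N)) -{}xz0 mulr_sumr horner_sum big_mkcond /=.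
  rewrite big_seq [RHS]big_seq; apply: eq_bigr => a ax.
  case: ifP => _; last by rewrite scaler0 mulr0.
  rewrite hornerZ hornerXn expr0 mul1r exprnP ge0 // expfzDr // mulrCA.
  by rewrite -exprnP -[_ *: _]/(_ * _) mulrA [RHS]mulrC [_ ^ _ * _]mulrC.
have P0 : P = 0.
  apply/eqP/negPn/negP => nP.
  pose rs := [seq (i.+1%:R : F) | i <- iota 0 (size P)].
  have: (size rs < size P)%N.
    apply: (max_poly_roots nP).
      by apply/allP=> _ /mapP[i _ ->]; rewrite /root Pz // pnatr_eq0.
    by rewrite map_inj_uniq ?iota_uniq // => i j /eqP; rewrite eqr_nat => /eqP[].
  by rewrite size_map size_iota ltnn.
have [bx|/mcoeff_outdom //] := boolP (b \in msupp x).
have := congr1 (coefp (e b)) P0; rewrite /= coef0 coef_sum.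
rewrite big_mkcond (bigD1_seq b) ?fset_uniq //= bp eqxx.
rewrite coefZ coefXn eqxx mulr1 big_seq_cond big1 ?addr0 // => a /andP[ax ab].
case: eqP => // ap; rewrite coefZ coefXn.
(* Within one parity the index determines the basis vector, so no other term reaches this
   exponent. *)
case: eqP => [eab|_]; last by rewrite mulr0.
have iab : idx a = idx b.
  by apply: (addIr N%:Z); rewrite -!ge0 // eab.
case/eqP: ab; move: iab ap; rewrite -bp.
by case: (a) (b) => m [] n //= ->.
Qed.

(** Values at all nonzero points determine the Laurent polynomial, so pointwise identities may be
    differentiated. *)
Lemma jet_ext p (x y : S) :
  (forall z, z != 0 -> jet p 0 z x = jet p 0 z y) ->
  forall k z, jet p k z x = jet p k z y.
Proof.
move=> xy k z; apply/eqP; rewrite -subr_eq0 -jetB; apply/eqP.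
have c0 := @jet_eq0_coef p (x - y) _.
rewrite /jet /lext big1 // => a _; case: eqP => [ap|_]; last by rewrite scaler0.
by rewrite c0 ?scale0r // => t t0; rewrite jetB xy ?subrr.
Qed.

Lemma jet_inj (x y : S) :
  (forall p z, z != 0 -> jet p 0 z x = jet p 0 z y) -> x = y.
Proof.
move=> xy; apply/malgP=> b; apply/eqP; rewrite -subr_eq0 -mcoeffB.
apply/eqP; apply: (@jet_eq0_coef (bparity b)) => // z z0.
by rewrite jetB xy ?subrr.
Qed.

(** Multiplication of both Laurent polynomials by z^n. *)
Definition shift (n : int) : S -> S :=
  lext (fun a => vec (match a with inl m => inl (m + n) | inr m => inr (m + n) end)).

HB.instance Definition _ n :=
  GRing.isLinear.Build F S S *:%R (shift n) (lext_is_linear _).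

Lemma jet_shift p n z x : z != 0 ->
  [/\ jet p 0 z (shift n x) = z ^ n * jet p 0 z x,
      jet p 1 z (shift n x) = z ^ n * (jet p 1 z x + n%:~R * jet p 0 z x) &
      jet p 2 z (shift n x) = z ^ n * (jet p 2 z x
        + 2 * n%:~R * jet p 1 z x + n%:~R ^+ 2 * jet p 0 z x)].
Proof.
move=> z0; move: x; apply: vec_ind => [|c a x [e0 e1 e2]].
  by rewrite linear0 !jet0; split; ring.
rewrite linearP /= !jetD !jetZ {}e0 {}e1 {}e2 /shift lext_vec !jet_vec.
case: a => m /=; case: eqP => _; rewrite ?expfzDr // ?rmorphD /=; split; ring.
Qed.

(** Solves linear relations: with explicit multipliers, the goal becomes an identity for [ring] or
    [field]. *)
Lemma eq_of_multiple (k a b x y : F) : a = b -> x - y = k * (a - b) -> x = y.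
Proof. by move=> -> /eqP; rewrite subrr mulr0 subr_eq0 => /eqP. Qed.

Lemma eq_of_lincomb (k l a b c d x y : F) :
  a = b -> c = d -> x - y = k * (a - b) + l * (c - d) -> x = y.
Proof.
by move=> -> -> /eqP; rewrite !subrr !mulr0 addr0 subr_eq0 => /eqP.
Qed.

(** * Local inner maps *)

Definition local_inner (T : S -> S) := forall x, exists a, T x = sbr a x.

(** The value of [a, x] at z involves x only through values and first derivatives at z, and its even
    part does not involve the derivative of the odd part of x. *)
Lemma local_inner_jet0 (T : S -> S) z x : local_inner T -> z != 0 ->
  jet false 0 z x = 0 -> jet true 0 z x = 0 ->
  (jet false 1 z x = 0 -> jet false 0 z (T x) = 0) /\
  (jet false 1 z x = 0 -> jet true 1 z x = 0 -> jet true 0 z (T x) = 0).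
Proof.
move=> lT z0 f0 g0; have [a ->] := lT x; have [-> _ -> _ _] := jet_bracket a x z0.
by rewrite f0 g0; split=> [->|-> ->]; field.
Qed.

(** Test elements are given as lists so that their jets reduce by computation. *)
Definition comb (s : seq (F * SVbasis)) : S := \sum_(t <- s) t.1 *: vec t.2.

Lemma linear_comb (T : {linear S -> S}) s :
  T (comb s) = \sum_(t <- s) t.1 *: T (vec t.2).
Proof. by rewrite linear_sum; apply: eq_bigr => t _; rewrite linearZ_LR. Qed.

Lemma jet_linear_comb (T : {linear S -> S}) p k z s :
  jet p k z (T (comb s)) =
    foldr (fun t r => t.1 * jet p k z (T (vec t.2)) + r) 0 s.
Proof.
rewrite linear_comb; elim: s => [|t s IH]; first by rewrite big_nil jet0.
by rewrite big_cons jetD jetZ IH.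
Qed.

Lemma jet_comb p k z s : jet p k z (comb s) = foldr (fun t r => t.1 *
  (if bparity t.2 == p then (idx t.2)%:~R ^+ k * z ^ idx t.2 else 0) + r) 0 s.
Proof.
rewrite /comb; elim: s => [|t s IH]; first by rewrite big_nil jet0.
by rewrite big_cons jetD jetZ IH jet_vec.
Qed.

(* x = L_f with f vanishing to second order at z, so that (T x)(z) = 0: hence T acts
   on L as a first order differential operator. *)
Lemma local_inner_jet_L (T : {linear S -> S}) p z m : local_inner T ->
  T (L 0) = 0 -> z != 0 ->
  jet p 0 z (T (L m)) = m%:~R * z ^ m / z * jet p 0 z (T (L 1)).
Proof.
move=> lT T0 z0.
(* Here f is t^m minus its tangent line at z. *)
pose x := comb [:: (1, inl m); (- (m%:~R * z ^ m / z), inl 1);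
                   (- ((1 - m%:~R) * z ^ m), inl 0)].
have f0 : jet false 0 z x = 0 by rewrite jet_comb /= expr0z expr1z; field.
have f1 : jet false 1 z x = 0 by rewrite jet_comb /= expr0z expr1z; field.
have g k : jet true k z x = 0 by rewrite jet_comb /=; ring.
have [h1 h2] := local_inner_jet0 lT z0 f0 (g 0).
have : jet p 0 z (T x) = 0 by case: p; [apply: h2 | apply: h1].
rewrite jet_linear_comb /= T0 jet0 => h.
by apply: (eq_of_multiple (k := 1) h); ring.
Qed.

Lemma jet_sbrL0 p z x : z != 0 -> jet p 0 z (sbr (L 0) x) = - jet p 1 z x.
Proof.
move=> z0; have [e _ o _ _] := jet_bracket (L 0) x z0.
by case: p; rewrite ?e ?o !jet_vec /= expr0z; field.
Qed.

(** It suffices that z d/dz fixes both parts of [h], which puts [h] in degree 1. In each case the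
    test element leaves a single unknown value of [a] in two derivatives of [T x], and eliminating
    it gives the relation. *)
Lemma local_inner_L1 (T : {linear S -> S}) : local_inner T -> T (L 0) = 0 ->
  exists c d, T (L 1) = c *: L 1 + d *: G 1.
Proof.
move=> lT T0; set h := T (L 1).
suff h10 p z : z != 0 -> jet p 1 z h = jet p 0 z h.
  exists h@_(inl 1), h@_(inr 1); apply: sum_two_coeffs => b nb.
  have hE : sbr (L 0) h = - h.
    apply: jet_inj => p z z0; rewrite jet_sbrL0 // h10 //.
    by rewrite -[- h]scaleN1r jetZ mulN1r.
  have := congr1 (mcoeff b) hE; rewrite mcoeff_sbrL0 mcoeffN mulNr => /oppr_inj.
  move/eqP; rewrite -subr_eq0 -[X in _ - X]mul1r -mulrBl mulf_eq0.
  by rewrite subr_eq0 (eqr_int _ _ 1) (negPf nb) => /eqP.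
move=> z0; case: p.
  (* x = L_f with f = (t - z)^2. *)
  pose x := comb [:: (1, inl 2); (- (2 * z), inl 1); (z ^+ 2, inl 0)].
  have f0 : jet false 0 z x = 0 by rewrite jet_comb /= -?exprnP; ring.
  have f1 : jet false 1 z x = 0 by rewrite jet_comb /= -?exprnP; ring.
  have f2 : jet false 2 z x = 2 * z ^+ 2 by rewrite jet_comb /= -?exprnP; ring.
  have f3 : jet false 3 z x = 6 * z ^+ 2 by rewrite jet_comb /= -?exprnP; ring.
  have g k : jet true k z x = 0 by rewrite jet_comb /=; ring.
  have TL2 k : jet true k z (T (L 2)) = jet true k z (2 *: shift 1 h).
    apply: jet_ext => t t0; rewrite (local_inner_jet_L _ _ lT T0 t0) [RHS]jetZ.
    by have [-> _ _] := jet_shift true 1 h t0; rewrite -/h -?exprnP; field.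
  have [s0 s1 s2] := jet_shift true 1 h z0.
  have [a Tx] := lT x; have [_ _ _ o1 o2] := jet_bracket a x z0.
  rewrite -Tx jet_linear_comb /= T0 jet0 -/h TL2 jetZ s1 f0 f1 f2 !g -?exprnP
    in o1.
  rewrite -Tx jet_linear_comb /= T0 jet0 -/h TL2 jetZ s2 f0 f1 f3 !g -?exprnP
    in o2.
  by apply: (eq_of_lincomb (k := 1 / (4 * z)) (l := - 3 / (4 * z)) o2 o1); field.
(* With f = t - z, the even part of [T x] and its derivative both equal -z u(z), where u is the even
   part of [a]. *)
pose x := comb [:: (1, inl 1); (- z, inl 0)].
have f0 : jet false 0 z x = 0 by rewrite jet_comb /= -?exprnP; ring.
have f1 : jet false 1 z x = z by rewrite jet_comb /= -?exprnP; ring.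
have f2 : jet false 2 z x = z by rewrite jet_comb /= -?exprnP; ring.
have g k : jet true k z x = 0 by rewrite jet_comb /=; ring.
have [a Tx] := lT x; have [e0 e1 _ _ _] := jet_bracket a x z0.
rewrite -Tx jet_linear_comb /= T0 jet0 -/h f0 f1 !g in e0.
rewrite -Tx jet_linear_comb /= T0 jet0 -/h f0 f2 !g in e1.
by apply: (eq_of_lincomb (k := 1) (l := - 1) e1 e0); ring.
Qed.

Lemma local_inner_sub (T : {linear S -> S}) w :
  local_inner T -> local_inner (T \- sbr w).
Proof. by move=> lT x; have [a /= ->] := lT x; exists (a - w); rewrite sbrBl. Qed.

Lemma local_inner_L (T : {linear S -> S}) : local_inner T ->
  exists w, forall m, T (L m) = sbr w (L m).
Proof.
move=> lT; have [w Tw] := lT (L 0).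
pose U : {linear S -> S} := T \- sbr w.
have lU : local_inner U := local_inner_sub w lT.
have U0 : U (L 0) = 0 by rewrite /U /= Tw subrr.
have [c [d U1]] := local_inner_L1 lU U0.
have UL m : U (L m) = (m%:~R * c) *: L m + (m%:~R * d) *: G m.
  apply: jet_inj => p z z0; rewrite (local_inner_jet_L _ _ lU U0 z0) U1.
  rewrite [jet p 0 z (_ + _)]jetD [in RHS]jetD [X in _ * (X + _)]jetZ.
  rewrite [X in _ * (_ + X)]jetZ [X in _ = X + _]jetZ [X in _ = _ + X]jetZ.
  by rewrite !jet_vec /= !expr0; case: p => /=; rewrite -?exprnP; field.
exists (w + ((- c) *: L 0 + (- 2 * d) *: G 0)) => m.
rewrite sbrDl -[LHS](subrK (sbr w (L m))) [LHS]addrC.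
apply: (congr2 +%R); first by [].
rewrite -[LHS]/(U (L m)) UL sbrDl !sbrZl sbrLL sbrGL !scalerA !add0r addr0.
by apply: eq_lincomb2; rewrite ?rmorphN /=; field.
Qed.

(** * Local inner maps that vanish on every [L m] *)

Section VanishingOnEvenPart.
Context {T : {linear S -> S}}.
Hypothesis lT : local_inner T.
Hypothesis TL : forall m, T (L m) = 0.

(** From odd to even, T is multiplication by a function, since t^m - z^m vanishes at z and no
    derivative of g enters. *)
Lemma jet_even_G z m : z != 0 ->
  jet false 0 z (T (G m)) = z ^ m * jet false 0 z (T (G 0)).
Proof.
move=> z0; pose x := comb [:: (1, inr m); (- z ^ m, inr 0)].
have f k : jet false k z x = 0 by rewrite jet_comb /=; ring.
have g0 : jet true 0 z x = 0 by rewrite jet_comb /= expr0z; ring.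
have [h _] := local_inner_jet0 lT z0 (f 0) g0.
have := h (f 1); rewrite jet_linear_comb /= => {}h.
by apply: (eq_of_multiple (k := 1) h); ring.
Qed.

(** From odd to odd, T is a first order operator; the test element is again t^m minus its tangent
    line at z. *)
Lemma jet_odd_G z m : z != 0 ->
  jet true 0 z (T (G m)) = m%:~R * z ^ m / z * jet true 0 z (T (G 1))
    + (1 - m%:~R) * z ^ m * jet true 0 z (T (G 0)).
Proof.
move=> z0; pose x := comb [:: (1, inr m); (- (m%:~R * z ^ m / z), inr 1);
                              (- ((1 - m%:~R) * z ^ m), inr 0)].
have f k : jet false k z x = 0 by rewrite jet_comb /=; ring.
have g0 : jet true 0 z x = 0 by rewrite jet_comb /= expr0z expr1z; field.
have g1 : jet true 1 z x = 0 by rewrite jet_comb /= expr0z expr1z; field.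
have [_ h] := local_inner_jet0 lT z0 (f 0) g0.
have := h (f 1) g1; rewrite jet_linear_comb /= => {}h.
by apply: (eq_of_multiple (k := 1) h); ring.
Qed.

Lemma jet12_G p z m :
  (forall t, t != 0 -> jet p 0 t (T (G m)) = t ^ m * jet p 0 t (T (G 0))) ->
  z != 0 ->
  jet p 1 z (T (G m)) =
    z ^ m * (jet p 1 z (T (G 0)) + m%:~R * jet p 0 z (T (G 0))) /\
  jet p 2 z (T (G m)) =
    z ^ m * (jet p 2 z (T (G 0)) + 2 * m%:~R * jet p 1 z (T (G 0))
      + m%:~R ^+ 2 * jet p 0 z (T (G 0))).
Proof.
move=> TG z0; have [_ <- <-] := jet_shift p m (T (G 0)) z0.
suff TGk k : jet p k z (T (G m)) = jet p k z (shift m (T (G 0))) by rewrite !TGk.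
apply: jet_ext => t t0; rewrite (TG t t0).
by have [-> _ _] := jet_shift p m (T (G 0)) t0.
Qed.

Lemma jet12_odd_G z m (u := T (G 0)) (v := T (G 1)) : z != 0 ->
  jet true 1 z (T (G m)) =
    m%:~R * z ^ m / z * (jet true 1 z v + (m%:~R - 1) * jet true 0 z v)
    + (1 - m%:~R) * z ^ m * (jet true 1 z u + m%:~R * jet true 0 z u) /\
  jet true 2 z (T (G m)) =
    m%:~R * z ^ m / z * (jet true 2 z v + 2 * (m%:~R - 1) * jet true 1 z v
                         + (m%:~R - 1) ^+ 2 * jet true 0 z v)
    + (1 - m%:~R) * z ^ m * (jet true 2 z u + 2 * m%:~R * jet true 1 z u
                         + m%:~R ^+ 2 * jet true 0 z u).
Proof.
(* The formula of [jet_odd_G] as an element, so that it can be differentiated. *)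
move=> z0; pose w := m%:~R *: shift (m - 1) v + (1 - m%:~R) *: shift m u.
have wE k t : jet true k t w = m%:~R * jet true k t (shift (m - 1) v)
    + (1 - m%:~R) * jet true k t (shift m u).
  by rewrite [LHS]jetD; apply: (congr2 +%R); exact: jetZ.
have Tw k : jet true k z (T (G m)) = jet true k z w.
  apply: jet_ext => t t0; rewrite (jet_odd_G _ t0) wE.
  have [-> _ _] := jet_shift true m u t0.
  have [-> _ _] := jet_shift true (m - 1) v t0.
  by rewrite expfzDr // exprN1; rewrite -/u -/v; field.
have [_ u1 u2] := jet_shift true m u z0.
have [_ v1 v2] := jet_shift true (m - 1) v z0.
rewrite !Tw !wE u1 u2 v1 v2 rmorphB /= expfzDr // exprN1.
by split; field.
Qed.

(** The difference of the two sides is, up to a factor z, the first order coefficient of T from odd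
    to odd. As g has a triple zero, only this coefficient survives in the second derivative of
    [T x]. The even equation kills the even part of [a] at z, and the two odd ones then differ by a
    factor 3 in its odd part. *)
Lemma jet_odd_G1 z : z != 0 ->
  jet true 0 z (T (G 1)) = z * jet true 0 z (T (G 0)).
Proof.
move=> z0.
(* x = L_f + G_g with f = (t - z)^2 and g = (t - z)^3. *)
pose x := comb [:: (1, inl 2); (- (2 * z), inl 1); (z ^+ 2, inl 0);
  (1, inr 3); (- (3 * z), inr 2); (3 * z ^+ 2, inr 1); (- z ^+ 3, inr 0)].
have f0 : jet false 0 z x = 0 by rewrite jet_comb /= -?exprnP; ring.
have f1 : jet false 1 z x = 0 by rewrite jet_comb /= -?exprnP; ring.
have f2 : jet false 2 z x = 2 * z ^+ 2 by rewrite jet_comb /= -?exprnP; ring.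
have f3 : jet false 3 z x = 6 * z ^+ 2 by rewrite jet_comb /= -?exprnP; ring.
have g0 : jet true 0 z x = 0 by rewrite jet_comb /= -?exprnP; ring.
have g1 : jet true 1 z x = 0 by rewrite jet_comb /= -?exprnP; ring.
have g2 : jet true 2 z x = 0 by rewrite jet_comb /= -?exprnP; ring.
have g3 : jet true 3 z x = 6 * z ^+ 3 by rewrite jet_comb /= -?exprnP; ring.
have e1 : jet false 1 z (T x) = 0.
  rewrite jet_linear_comb /= !TL !jet0.
  have TG m := (jet12_G (fun t => @jet_even_G t m) z0).1.
  rewrite (TG 3) (TG 2) (TG 1).
  by rewrite -?exprnP; ring.
have o1 : jet true 1 z (T x) = 0.
  rewrite jet_linear_comb /= !TL !jet0.
  rewrite (jet12_odd_G 3 z0).1 (jet12_odd_G 2 z0).1.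
  by rewrite -?exprnP; field.
have o2 : jet true 2 z (T x) =
    6 * z ^+ 2 * (jet true 0 z (T (G 1)) - z * jet true 0 z (T (G 0))).
  rewrite jet_linear_comb /= !TL !jet0.
  rewrite (jet12_odd_G 3 z0).2 (jet12_odd_G 2 z0).2.
  by rewrite -?exprnP; field.
have [a Ta] := lT x; have [_ b1 _ c1 c2] := jet_bracket a x z0.
rewrite -Ta e1 f0 f2 g0 g1 in b1.
rewrite -Ta o1 f0 f1 f2 g0 g1 g2 in c1.
rewrite -Ta o2 f0 f1 f3 g0 g2 g3 in c2.
have a0 : jet false 0 z a = 0.
  by apply: (eq_of_multiple (k := 1 / (2 * z ^+ 2)) b1); field.
rewrite a0 in c2.
by apply: (eq_of_lincomb (k := 1 / (6 * z ^+ 2)) (l := - 1 / (2 * z ^+ 2)) c2 c1);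
  field.
Qed.

Lemma jet_odd_G_shift z m : z != 0 ->
  jet true 0 z (T (G m)) = z ^ m * jet true 0 z (T (G 0)).
Proof. by move=> z0; rewrite (jet_odd_G m z0) jet_odd_G1 //; field. Qed.

(* If x = G_g and g has a simple zero at z, then [a, x] = G_h where h(z) = 0 forces
   u(z) = 0, and then the first two derivatives of h at z only involve u'(z). *)
Lemma local_inner_simple_zero z x : z != 0 ->
  (forall k, jet false k z x = 0) -> jet true 0 z x = 0 ->
  jet true 1 z x != 0 -> jet true 0 z (T x) = 0 ->
  jet true 1 z x * jet true 2 z (T x) = 3 * jet true 2 z x * jet true 1 z (T x).
Proof.
move=> z0 f g0 g1 Tx0.
have [a Ta] := lT x; have [_ _ o0 o1 o2] := jet_bracket a x z0.
rewrite -Ta Tx0 g0 !f in o0; rewrite -Ta g0 !f in o1; rewrite -Ta g0 !f in o2.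
have a0 : jet false 0 z a = 0.
  by apply: (eq_of_multiple (k := 1 / jet true 1 z x) o0); field.
by rewrite o1 o2 a0; field.
Qed.

(** By now T multiplies the odd part by a function. The simple zeros t - z and t (t - z) give
    [u1 = u0] and [u1 = 3 * u0]. *)
Lemma jet_odd_G0 z : z != 0 -> jet true 0 z (T (G 0)) = 0.
Proof.
move=> z0; have TG m := jet12_G (fun t => @jet_odd_G_shift t m) z0.
have TG0 m := jet_odd_G_shift m z0.
set u0 := jet true 0 z (T (G 0)); set u1 := jet true 1 z (T (G 0)).
set u2 := jet true 2 z (T (G 0)).
have e1 : z * (z * (2 * u1 + u0)) = 3 * z * (z * u0).
  pose x := comb [:: (1, inr 1); (- z, inr 0)].
  have f k : jet false k z x = 0 by rewrite jet_comb /=; ring.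
  have g0 : jet true 0 z x = 0 by rewrite jet_comb /= -?exprnP; ring.
  have g1 : jet true 1 z x = z by rewrite jet_comb /= -?exprnP; ring.
  have g2 : jet true 2 z x = z by rewrite jet_comb /= -?exprnP; ring.
  have Tx0 : jet true 0 z (T x) = 0.
    by rewrite jet_linear_comb /= (TG0 1) -?exprnP; ring.
  have Tx1 : jet true 1 z (T x) = z * u0.
    by rewrite jet_linear_comb /= (TG 1).1 -?exprnP -/u1 -/u0; ring.
  have Tx2 : jet true 2 z (T x) = z * (2 * u1 + u0).
    by rewrite jet_linear_comb /= (TG 1).2 -?exprnP -/u2 -/u1 -/u0; ring.
  have := local_inner_simple_zero z0 f g0 _ Tx0.
  by rewrite g1 g2 Tx1 Tx2; apply.
have e2 : z ^+ 2 * (z ^+ 2 * (2 * u1 + 3 * u0)) = 3 * (3 * z ^+ 2) * (z ^+ 2 * u0).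
  pose x := comb [:: (1, inr 2); (- z, inr 1)].
  have f k : jet false k z x = 0 by rewrite jet_comb /=; ring.
  have g0 : jet true 0 z x = 0 by rewrite jet_comb /= -?exprnP; ring.
  have g1 : jet true 1 z x = z ^+ 2 by rewrite jet_comb /= -?exprnP; ring.
  have g2 : jet true 2 z x = 3 * z ^+ 2 by rewrite jet_comb /= -?exprnP; ring.
  have Tx0 : jet true 0 z (T x) = 0.
    by rewrite jet_linear_comb /= (TG0 2) (TG0 1) -?exprnP; ring.
  have Tx1 : jet true 1 z (T x) = z ^+ 2 * u0.
    by rewrite jet_linear_comb /= (TG 2).1 (TG 1).1 -?exprnP -/u1 -/u0; ring.
  have Tx2 : jet true 2 z (T x) = z ^+ 2 * (2 * u1 + 3 * u0).
    rewrite jet_linear_comb /= (TG 2).2 (TG 1).2 -?exprnP -/u2 -/u1 -/u0.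
    by ring.
  have := local_inner_simple_zero z0 f g0 _ Tx0.
  by rewrite g1 g2 Tx1 Tx2; apply; rewrite expf_neq0.
by apply: (eq_of_lincomb (k := 1 / (4 * z ^+ 2)) (l := - 1 / (4 * z ^+ 4)) e1 e2);
  field.
Qed.

(** The odd part of [T x] is now zero. Its value and two derivatives at z force, in turn, the even
    part of [a], its derivative and the odd part of [a] to vanish there. The derivative of the even
    part of [T x], z times the value sought, is then zero. *)
Lemma jet_even_G0 z : z != 0 -> jet false 0 z (T (G 0)) = 0.
Proof.
move=> z0; have TGe m := (jet12_G (fun t => @jet_even_G t m) z0).1.
have TGo k m : jet true k z (T (G m)) = 0.
  rewrite -(jet0 true k z); apply: jet_ext => t t0.
  by rewrite jet_odd_G_shift // jet_odd_G0 // mulr0 jet0.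
(* x = L_f + G_g with f = (t - z)^3 and g = t - z. *)
pose x := comb [:: (1, inl 3); (- (3 * z), inl 2); (3 * z ^+ 2, inl 1);
  (- z ^+ 3, inl 0); (1, inr 1); (- z, inr 0)].
have f0 : jet false 0 z x = 0 by rewrite jet_comb /= -?exprnP; ring.
have f1 : jet false 1 z x = 0 by rewrite jet_comb /= -?exprnP; ring.
have f2 : jet false 2 z x = 0 by rewrite jet_comb /= -?exprnP; ring.
have f3 : jet false 3 z x = 6 * z ^+ 3 by rewrite jet_comb /= -?exprnP; ring.
have g0 : jet true 0 z x = 0 by rewrite jet_comb /= -?exprnP; ring.
have g1 : jet true 1 z x = z by rewrite jet_comb /= -?exprnP; ring.
have g2 : jet true 2 z x = z by rewrite jet_comb /= -?exprnP; ring.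
have g3 : jet true 3 z x = z by rewrite jet_comb /= -?exprnP; ring.
have e1 : jet false 1 z (T x) = z * jet false 0 z (T (G 0)).
  by rewrite jet_linear_comb /= !TL !jet0 (TGe 1) -?exprnP; ring.
have o k : jet true k z (T x) = 0.
  by rewrite jet_linear_comb /= !TL !jet0 !TGo; ring.
have [a Ta] := lT x; have [_ b1 c0 c1 c2] := jet_bracket a x z0.
rewrite -Ta e1 f0 f2 g0 g1 in b1; rewrite -Ta o f0 f1 g0 g1 in c0.
rewrite -Ta o f0 f1 f2 g0 g1 g2 in c1; rewrite -Ta o f0 f1 f3 g0 g2 g3 in c2.
have a0 : jet false 0 z a = 0 by apply: (eq_of_multiple (k := 1 / z) c0); field.
have a1 : jet false 1 z a = 0.
  by rewrite a0 in c1; apply: (eq_of_multiple (k := 2 / z) c1); field.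
have v0 : jet true 0 z a = 0.
  by rewrite a0 a1 in c2; apply: (eq_of_multiple (k := 1 / (3 * z ^+ 3)) c2); field.
by rewrite v0 in b1; apply: (eq_of_multiple (k := 1 / z) b1); field.
Qed.

Lemma local_inner_G0 m : T (G m) = 0.
Proof.
apply: jet_inj => p z z0; rewrite jet0; case: p.
  by rewrite jet_odd_G_shift // jet_odd_G0 // mulr0.
by rewrite jet_even_G // jet_even_G0 // mulr0.
Qed.

End VanishingOnEvenPart.

Lemma local_inner_is_inner (T : {linear S -> S}) : local_inner T ->
  exists w, T =1 sbr w.
Proof.
move=> lT; have [w Tw] := local_inner_L lT; exists w.
pose U : {linear S -> S} := T \- sbr w.
have lU : local_inner U := local_inner_sub w lT.
have UL m : U (L m) = 0 by rewrite /U /= Tw subrr.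
apply: linear_basis_eq => -[] m; first exact: Tw.
by apply/eqP; rewrite -subr_eq0; apply/eqP; exact: (local_inner_G0 lU UL m).
Qed.

Theorem local_der_is_der (T : S -> S) : local_der T -> der T.
Proof.
case=> Tlin lT; pose U : {linear S -> S} :=
  HB.pack T (GRing.isLinear.Build F S S *:%R T Tlin).
have [x|w Uw] := @local_inner_is_inner U.
  have [D [/der_inner[w Dw] TD]] := lT x.
  by exists w; rewrite -Dw.
have [D0 [D1 [h0 h1 wD]]] := der_ad w.
by exists D0, D1; split=> // x; rewrite -wD; exact: Uw.
Qed.

End SuperVirasoro.

(** * Transfer to complex coefficients *)

Lemma svbrE (R : realType) : @svbr R = @sbr (CC R).
Proof. by rewrite sbr.unlock. Qed.

Lemma hom_derivationE (R : realType) d (D : SV R -> SV R) :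
  hom_derivation d D = @hom_der (CC R) d D.
Proof. by rewrite /hom_derivation svbrE. Qed.

Lemma is_derivationP (R : realType) (D : SV R -> SV R) :
  is_derivation D <-> @der (CC R) D.
Proof.
split=> -[D0 [D1 [h0 h1 DE]]]; exists D0, D1.
  by rewrite !hom_derivationE in h0 h1; exact: And3 h0 h1 DE.
by rewrite -!hom_derivationE in h0 h1; exact: And3 h0 h1 DE.
Qed.

Theorem theorem4p3 (R : realType) (T : SV R -> SV R) :
  is_local_derivation T -> is_derivation T.
Proof.
case=> Tlin lT; apply/is_derivationP; apply: local_der_is_der.
by split; [exact: Tlin|move=> x; have [D [/is_derivationP dD TD]] := lT x; exists D].
Qed.
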